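(* Let $n$ and $k$ be integers with $k\geq 2$ and $n\geq 3k$. Let $\mathcal{L}_n^k$ be the set of all linear forests of order $n$ with at least $n-k+1$ edges. Then \[ ex(n;\mathcal{L}_n^k)\leq \binom{n-k+1}{2}+\frac{k^2-3k+4}{2}. \]
   Context: All graphs are finite and simple. A linear forest is a graph whose connected components are all paths and isolated vertices (an isolated vertex is viewed as a path of length zero). For a set of graphs $\mathcal{F}$, the extremal number $ex(n;\mathcal{F})$ is the maximum number of edges in a graph of order $n$ (i.e. with $n$ vertices) not containing any subgraph (not necessarily induced) isomorphic to some graph in $\mathcal{F}$. *)

(* Defs.v *)
From HB Require Import structures.
From mathcomp Require Import all_boot all_order all_algebra.
From mathcomp Require Import boolp.

Set Implicit Arguments.
Unset Strict Implicit.
Unset Printing Implicit Defensive.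

(* Simple graphs with vertex set T: the edges are two-element subsets of T. *)
Record sgraph (T : finType) := SGraph {
  edges :> {set {set T}};
  edges_card2 : [forall A in edges, #|A| == 2] }.

HB.instance Definition _ (T : finType) := [isSub for @edges T].
HB.instance Definition _ (T : finType) := [Finite of sgraph T by <:].

Definition adj (T : finType) (G : sgraph T) : rel T :=
  fun x y => [set x; y] \in edges G.

Definition rel_edges (T : finType) (r : rel T) : {set {set T}} :=
  [set [set p.1; p.2] | p : T * T & (p.1 != p.2) && r p.1 p.2].

Lemma rel_edges_card2 (T : finType) (r : rel T) :
  [forall A in rel_edges r, #|A| == 2].
Proof.
apply/forall_inP => A /imsetP[[x y]]; rewrite inE /= => /andP[xy _] ->.
by rewrite cards2 xy.
Qed.

Definition rel_sgraph (T : finType) (r : rel T) : sgraph T :=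
  SGraph (rel_edges_card2 r).

Lemma adj_rel_sgraph (T : finType) (r : rel T) (x y : T) :
  adj (rel_sgraph r) x y = (x != y) && (r x y || r y x).
Proof.
apply/imsetP/andP => [[[a b]]|[xy /orP[rxy|ryx]]]; last 2 first.
- by exists (x, y); rewrite ?inE /= ?xy.
- by exists (y, x); rewrite ?inE /= 1?eq_sym ?xy // setUC.
rewrite inE /= => /andP[ab rab] eq_xy.
have xab : x \in [set a; b] by rewrite -eq_xy set21.
have yab : y \in [set a; b] by rewrite -eq_xy set22.
have := cards2 x y; rewrite eq_xy cards2 ab; case: eqVneq => // xy _.
by move: xab yab xy; rewrite !inE => /orP[] /eqP-> /orP[] /eqP->;
  rewrite ?eqxx ?rab ?orbT.
Qed.

Definition isomorphic (T U : finType) (G : sgraph T) (H : sgraph U) : Prop :=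
  exists2 f : T -> U, bijective f & forall x y, adj H (f x) (f y) = adj G x y.

Definition subgraph (T : finType) (G : sgraph T) (W : {set T})
    (K : sgraph {x : T | x \in W}) : Prop :=
  forall x y, adj K x y -> adj G (val x) (val y).

Definition contains (T U : finType) (G : sgraph T) (H : sgraph U) : Prop :=
  exists (W : {set T}) (K : sgraph {x : T | x \in W}),
    subgraph G K /\ isomorphic K H.

Definition induced (T : finType) (G : sgraph T) (W : {set T}) :
    sgraph {x : T | x \in W} :=
  rel_sgraph (fun x y => adj G (val x) (val y)).

Definition component (T : finType) (G : sgraph T) (x : T) : {set T} :=
  [set y | connect (adj G) x y].

(* The path of length l, with l edges and l.+1 vertices. *)
Definition path_graph (l : nat) : sgraph 'I_l.+1 :=
  rel_sgraph (fun i j : 'I_l.+1 => i.+1 == j :> nat).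

Definition linear_forest (T : finType) (G : sgraph T) : Prop :=
  forall x : T, exists l : nat,
    isomorphic (induced G (component G x)) (path_graph l).

Definition graph_family := forall T : finType, sgraph T -> Prop.

Definition family_free (F : graph_family) (T : finType) (G : sgraph T) : Prop :=
  forall (U : finType) (H : sgraph U), F U H -> ~ contains G H.

(* As \max over an empty range is 0, ex n F is the intended maximum as soon as
   some graph of order n is F-free, e.g. when all members of F have an edge. *)
Definition ex (n : nat) (F : graph_family) : nat :=
  \max_(G : sgraph 'I_n | `[< family_free F G >]) #|edges G|.

Definition linear_forests (n k : nat) : graph_family :=
  fun T G => [/\ #|T| = n, linear_forest G & n - k + 1 <= #|edges G|].

(* Main.v *)
Require Import Defs.
From mathcomp Require Import all_boot all_order all_algebra.
From mathcomp Require Import boolp zify lra.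
Import Order.TTheory GRing.Theory Num.Theory.

(** A graph contains a linear forest of order [n] with at least [n - k + 1] edges
    iff some enumeration of its vertices has at least [n - k + 1] links, i.e.
    adjacent pairs of consecutive vertices.  In an edge-maximal graph without
    such an enumeration, two nonadjacent vertices [u], [v] are the ends of an
    enumeration with [n - k] links, and Ore's rotation argument (where at least
    one non-link remains because [k >= 2]) gives [d(u) + d(v) <= n - k].
    Chvatal's degree count, applied to a nonadjacent pair with [d(u) + d(v)]
    maximal, then bounds the degree sum by a function that is convex in
    [s = min(d(u), d(v)) <= (n - k) / 2]; for [n >= 3k] its maximum is within
    the claimed bound. *)

Set Implicit Arguments.
Unset Strict Implicit.
Unset Printing Implicit Defensive.

(** * Links of an enumeration *)

Section Links.
Variable T : eqType.
Implicit Types (e : rel T) (s : seq T).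

Definition nlinks e s := count (fun p => e p.1 p.2) (zip s (behead s)).

Lemma nlinks_cons2 e x y s : nlinks e [:: x, y & s] = e x y + nlinks e (y :: s).
Proof. by []. Qed.

Lemma nlinks_cat e s1 x y s2 :
  nlinks e (rcons s1 x ++ y :: s2) = nlinks e (rcons s1 x) + e x y + nlinks e (y :: s2).
Proof.
elim: s1 => [|a [|b s1] IH] //=; rewrite ?nlinks_cons2 /=.
  by rewrite /nlinks /=; lia.
by rewrite /= in IH; rewrite IH; lia.
Qed.

Lemma nlinks_rev e s : symmetric e -> nlinks e (rev s) = nlinks e s.
Proof.
move=> es; elim: s => [|a [|b s] IH] //.
rewrite nlinks_cons2 -IH rev_cons [in LHS]rev_cons -cats1 nlinks_cat.
by rewrite -rev_cons es /nlinks /=; lia.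
Qed.

Lemma infix_zip x y s : infix [:: x; y] s -> (x, y) \in zip s (behead s).
Proof.
case/infixP=> p [q ->]; elim: p => [|a [|b p] IH] /=; rewrite ?inE ?eqxx ?orbT //.
by rewrite /= in IH; rewrite IH orbT.
Qed.

Lemma nlinks_count_lt e s : nlinks e s < (size s).-1 ->
  exists s1 x y s2, s = rcons s1 x ++ y :: s2 /\ ~~ e x y.
Proof.
elim: s => [|a [|b s] IH] //; rewrite nlinks_cons2 /=.
case: (boolP (e a b)) => [eab|neab _]; last by exists [::], a, b, s.
rewrite add1n ltnS => /IH[s1 [x [y [s2 [-> nxy]]]]].
by exists (a :: s1), x, y, s2.
Qed.

Lemma sub_nlinks e e' s :
  (forall x y, infix [:: x; y] s -> e x y -> e' x y) -> nlinks e s <= nlinks e' s.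
Proof.
elim: s => [|a [|b s] IH] // sub; rewrite !nlinks_cons2 leq_add //.
  case: (boolP (e a b)) => // /sub -> //.
  by apply/infixP; exists [::], s.
apply: IH => x y xy; apply: sub; exact: (infix_catl [:: a]).
Qed.

(** Sum the hypothesis over all consecutive pairs [z], [w]: the [w] run through [t] and the [z]
    through [belast x t], so the left sides add up to the two counts. *)
Lemma count_ends_le_nlinks e u v x t :
  (forall p z w q, x :: t = rcons p z ++ w :: q -> e u w + e z v <= e z w) ->
  count (e u) t + count (e^~ v) (belast x t) <= nlinks e (x :: t).
Proof.
elim: t x => [|y t IH] x //= H; rewrite nlinks_cons2.
have := H [::] x y t erefl.
have /IH : forall p z w q, y :: t = rcons p z ++ w :: q -> e u w + e z v <= e z w.
  by move=> p z w q E; apply: (H (x :: p) z w q); rewrite /= -E.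
by lia.
Qed.

End Links.

(** * Degrees, edge counts and embeddings *)

Section Graphs.
Variable T : finType.
Implicit Types (G : sgraph T) (s : seq T) (x y u v : T).

Definition deg G x := #|[set y | adj G x y]|.

Lemma adj_sym G : symmetric (adj G).
Proof. by move=> x y; rewrite /adj setUC. Qed.

Lemma adj_irrefl G x : adj G x x = false.
Proof.
apply/negP => xx; have /forall_inP/(_ _ xx) := edges_card2 G.
by rewrite setUid cards1.
Qed.

Lemma edge_set2 G A x : A \in edges G -> x \in A -> exists2 y, adj G x y & A = [set x; y].
Proof.
move=> AG xA; have /forall_inP/(_ _ AG)/cards2P[a [b [ab EA]]] := edges_card2 G.
move: xA; rewrite EA !inE => /orP[]/eqP->.
  by exists b; rewrite // /adj -EA.
by exists a; rewrite /adj setUC -?EA.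
Qed.

Lemma card_edges_le_sum_deg G : #|edges G|.*2 <= \sum_x deg G x.
Proof.
have -> : #|edges G|.*2 = \sum_(A in edges G) #|A|.
  rewrite -muln2 -sum_nat_const; apply: eq_bigr => A AG.
  by have /forall_inP/(_ _ AG)/eqP := edges_card2 G.
under eq_bigr => A _ do rewrite -sum1_card.
rewrite (exchange_big_dep predT) //=; apply: leq_sum => x _.
rewrite sum1_card; apply: leq_trans (leq_imset_card (fun y => [set x; y]) _).
apply/subset_leq_card/subsetP => A; rewrite unfold_in => /andP[AG xA].
have [y xy ->] := edge_set2 AG xA.
by apply/imsetP; exists y; rewrite ?inE.
Qed.

(** The edges are covered by the unordered pairs underlying the links of [s]. *)
Lemma card_edges_le_nlinks G s :
  (forall x y, adj G x y -> infix [:: x; y] s \/ infix [:: y; x] s) ->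
  #|edges G| <= nlinks (adj G) s.
Proof.
move=> H; rewrite /nlinks -size_filter.
set l := filter _ _.
rewrite -(size_map (fun p => [set p.1; p.2])); apply: leq_trans (card_size _).
apply/subset_leq_card/subsetP => A AG.
have /card_gt0P[x xA] : 0 < #|A|.
  by have /forall_inP/(_ _ AG)/eqP -> := edges_card2 G.
have [y xy ->] := edge_set2 AG xA.
have [/infix_zip h|/infix_zip h] := H _ _ xy.
  by apply/mapP; exists (x, y); rewrite ?mem_filter //= xy.
by apply/mapP; exists (y, x); rewrite ?mem_filter /= 1?setUC // adj_sym xy.
Qed.

Lemma add_edge_card2 G u v : u != v ->
  [forall A in [set u; v] |: edges G, #|A| == 2].
Proof.
move=> uv; apply/forall_inP => A; rewrite !inE => /orP[/eqP->|AG].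
  by rewrite cards2 uv.
by have /forall_inP/(_ _ AG) := edges_card2 G.
Qed.

Definition add_edge G u v (uv : u != v) : sgraph T := SGraph (add_edge_card2 G uv).

Lemma set2_eq u v x y : [set x; y] = [set u; v] -> (x = u /\ y = v) \/ (x = v /\ y = u).
Proof.
move=> E; have [xE yE] : x \in [set u; v] /\ y \in [set u; v] by rewrite -E !inE !eqxx orbT.
have [uE vE] : u \in [set x; y] /\ v \in [set x; y] by rewrite E !inE !eqxx orbT.
move: xE yE uE vE; rewrite !inE.
by do 4![case/orP=> /eqP ?]; subst; auto.
Qed.

End Graphs.

(** The copy is spanning, so [W] is all of [T] and [K] is [H] transported along [f]. *)
Lemma contains_embedding (T U : finType) (H : sgraph U) (G : sgraph T) (f : U -> T) :
  bijective f -> (forall a b, adj H a b -> adj G (f a) (f b)) -> contains G H.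
Proof.
move=> [g fK gK] fadj; exists [set: T].
pose K : sgraph {x : T | x \in [set: T]} :=
  rel_sgraph (fun a b => adj H (g (val a)) (g (val b))).
exists K; split.
  move=> x y; rewrite adj_rel_sgraph (adj_sym H (g (val y))) orbb => /andP[_ /fadj].
  by rewrite !gK.
exists (fun a => g (val a)).
  exists (fun y => exist _ (f y) (in_setT (f y))) => x /=; last exact: fK.
  by apply: val_inj; rewrite /= gK.
move=> x y; rewrite adj_rel_sgraph (adj_sym H (g (val y))) orbb.
by case: eqP => // ->; rewrite adj_irrefl.
Qed.

Lemma contains_inj (T U : finType) (H : sgraph U) (G : sgraph T) : contains G H ->
  exists2 f : U -> T, injective f & forall a b, adj H a b -> adj G (f a) (f b).
Proof.
move=> [W [K [sub [f [g fK gK] fadj]]]].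
exists (fun a => val (g a)); first exact: inj_comp val_inj (can_inj gK).
by move=> x y xy; apply: sub; rewrite -fadj !gK.
Qed.

(** * From a linear forest to an enumeration *)

Section LinearForestToSeq.
Variables (U : finType) (H : sgraph U).

Lemma component_seq x : (exists l, isomorphic (induced H (component H x)) (path_graph l)) ->
  exists s, [/\ uniq s, s =i component H x & forall y z, y \in component H x ->
    adj H y z -> infix [:: y; z] s \/ infix [:: z; y] s].
Proof.
move=> [l [f [g fK gK] fadj]].
(* The component is listed in the order of its path, so adjacent vertices become neighbours in the
   list. *)
pose s := [seq val (g (inord i)) | i <- iota 0 l.+1].
have consec (y z : {y | y \in component H x}) : (f y).+1 = f z :> nat -> infix [:: val y; val z] s.
  move=> yz; apply/infixP; exists (take (f y) s), (drop (f y).+2 s).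
  have szs : size s = l.+1 by rewrite size_map size_iota.
  have fz := ltn_ord (f z).
  rewrite -[LHS](cat_take_drop (f y)) (drop_nth (val y)) ?szs //.
  rewrite (drop_nth (val y)) ?szs ?yz //=.
  rewrite !(nth_map 0) ?size_iota // ?nth_iota //.
  by rewrite !add0n !inord_val !fK.
exists s; split.
- rewrite map_inj_in_uniq ?iota_uniq // => i j; rewrite !mem_iota /= => ilt jlt.
  move/val_inj/(can_inj gK)/(congr1 (@nat_of_ord _)).
  by rewrite !inordK.
- move=> y; apply/mapP/idP => [[i _ ->]|yC]; first exact: valP.
  exists (nat_of_ord (f (exist _ y yC))); first by rewrite mem_iota /=.
  by rewrite inord_val fK.
- move=> y z yC yz.
  have zC : z \in component H x.
    by move: yC; rewrite !inE => /connect_trans; apply; apply: connect1.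
  have neq : y != z by apply/eqP => yz0; rewrite yz0 adj_irrefl in yz.
  have := fadj (exist _ y yC) (exist _ z zC).
  rewrite /induced !adj_rel_sgraph /= yz -val_eqE /= neq /=.
  by case/andP=> _ /orP[]/eqP/consec; auto.
Qed.

Lemma linear_forest_seq : linear_forest H ->
  exists s, [/\ uniq s, s =i predT & forall y z,
    adj H y z -> infix [:: y; z] s \/ infix [:: z; y] s].
Proof.
(* Generalize from the whole vertex set to any set closed under adjacency, then split off one
   component at a time and concatenate the lists. *)
move=> LF; suff [s [us sE sH]] : exists s, [/\ uniq s, s =i [set: U] & forall y z,
  y \in [set: U] -> adj H y z -> infix [:: y; z] s \/ infix [:: z; y] s].
  by exists s; split=> // [x|x y]; [rewrite sE inE | apply: sH; rewrite inE].
have : forall y z, adj H y z -> (y \in [set: U]) = (z \in [set: U]) by move=> ? ?; rewrite !inE.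
have [m] := ubnP #|[set: U]|; elim: m [set: U] => // m IH X cardX clX.
have [->|[x xX]] := set_0Vmem X.
  by exists [::]; split=> // [x|y z]; rewrite inE.
have CX : component H x \subset X.
  apply/subsetP => y; rewrite inE => /closed_connect <- //; exact: clX.
have clC y z : adj H y z -> (y \in component H x) = (z \in component H x).
  move=> yz; rewrite !inE; apply: same_connect_r; first exact: sym_connect_sym (adj_sym H).
  exact: connect1.
have [s1 [u1 E1 H1]] := component_seq (LF x).
have [|y z yz|s2 [u2 E2 H2]] := IH (X :\: component H x).
- apply: leq_trans (_ : #|X| <= _); last by rewrite -ltnS.
  apply: proper_card; apply/properP; split; first exact: subsetDl.
  by exists x; rewrite // !inE connect0.
- by rewrite !in_setD (clX _ _ yz) (clC _ _ yz).
exists (s1 ++ s2); split.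
- rewrite cat_uniq u1 u2 andbT; apply/hasPn => y.
  by rewrite E2 E1 inE => /andP[].
- move=> y; rewrite mem_cat E1 E2 in_setD; case: (boolP (y \in component H x)) => //=.
  by move/(subsetP CX) ->.
- move=> y z yX yz; case: (boolP (y \in component H x)) => yC.
    by have [h|h] := H1 _ _ yC yz; [left|right]; apply: infix_catr.
  have [|h|h] := H2 y z _ yz; first by rewrite inE yC.
    by left; apply: infix_catl.
  by right; apply: infix_catl.
Qed.

End LinearForestToSeq.

(** * From an enumeration to a linear forest *)

Section IntervalForest.
Variables (m : nat) (b : pred nat).

(** Model of the links of an enumeration of [m.+1] vertices: [b] marks the positions at which an
    entry is linked to the next one. *)
Definition interval_forest : sgraph 'I_m.+1 :=
  rel_sgraph (fun i j : 'I_m.+1 => (i.+1 == j :> nat) && b i).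

Lemma adj_interval_forest (i j : 'I_m.+1) :
  adj interval_forest i j = (i.+1 == j :> nat) && b i || (j.+1 == i :> nat) && b j.
Proof.
rewrite adj_rel_sgraph; case: eqVneq => //= ->.
by rewrite -(inj_eq succn_inj); case: eqP => //; lia.
Qed.

(** With [interval_right], this delimits the maximal run of marked positions around [i]; the last
    clause, which tells why the run stops, shows later that no edge leaves it. *)
Lemma interval_left i : exists a, [/\ a <= i, forall j, a <= j < i -> b j & a = 0 \/ ~~ b a.-1].
Proof.
elim: i => [|i [a [ai H e]]]; first by exists 0; split; [by []|move=> j; lia|by left].
case: (boolP (b i)) => bi; last by exists i.+1; split; [by []|move=> j; lia|by right].
exists a; split=> // [|j aj]; first by apply: leqW.
by have [->//|ij] := eqVneq j i; apply: H; lia.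
Qed.

Lemma interval_right i : i <= m ->
  exists c, [/\ i <= c <= m, forall j, i <= j < c -> b j & c = m \/ ~~ b c].
Proof.
move=> im; have [d E] : exists d, m - i = d by exists (m - i).
elim: d i im E => [|d IH] i im E.
  by exists i; split; [lia|move=> j; lia|by left; lia].
case: (boolP (b i)) => bi; last by exists i; split; [lia|move=> j; lia|by right].
have [||c [ic H e]] := IH i.+1; [lia|lia|].
exists c; split=> // [|j aj]; first by lia.
by have [->//|ij] := eqVneq j i; apply: H; lia.
Qed.

Lemma interval_component i : exists a c, [/\ a <= c <= m, forall j, a <= j < c -> b j &
  component interval_forest i = [set j : 'I_m.+1 | a <= j <= c]].
Proof.
have [a [ai Ha ea]] := interval_left i.
have [c [ic Hc ec]] := interval_right (leq_ord i).
have Hb j : a <= j < c -> b j.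
  by move=> jac; have [ji|ij] := ltnP j i; [apply: Ha|apply: Hc]; lia.
exists a, c; split=> //; first by lia.
have csym : connect_sym (adj interval_forest).
  by apply: sym_connect_sym; apply: adj_sym.
have from_a d : a + d <= c -> connect (adj interval_forest) (inord a) (inord (a + d)).
  elim: d => [|d IH] dc; first by rewrite addn0 connect0.
  apply: connect_trans (IH _) (connect1 _); first by lia.
  rewrite adj_interval_forest !inordK; try lia.
  by rewrite Hb ?andbT ?addnS ?eqxx //; lia.
have connE (j : 'I_m.+1) : a <= j <= c -> connect (adj interval_forest) (inord a) j.
  move=> /andP[aj jc]; have := from_a (j - a).
  by rewrite subnKC // inord_val; apply.
apply/setP => j; rewrite !inE; apply/idP/idP => [ij|jac]; last first.
  by apply: connect_trans (connE j jac); rewrite csym connE //; lia.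
(* An edge leaving the interval would sit at position [a.-1] or [c], where [b] fails or the vertex
   range ends. *)
have cl : closed (adj interval_forest) [pred j : 'I_m.+1 | a <= j <= c].
  apply: (intro_closed csym) => x y; rewrite adj_interval_forest !inE.
  case/orP=> /andP[/eqP E bx] /andP[xa xc].
    case: ec => [cm|nbc]; first by have := ltn_ord y; lia.
    have : x != c :> nat by apply: contra nbc => /eqP <-.
    by lia.
  case: ea => [a0|nba]; first by lia.
  have : x != a :> nat by apply: contra nba => /eqP <-; rewrite -E.
  by lia.
by have := closed_connect cl ij; rewrite !inE => <-; lia.
Qed.

Lemma linear_forest_interval : linear_forest interval_forest.
Proof.
move=> i; have [a [c [acm Hb ->]]] := interval_component i.
exists (c - a).
set C := [set j : 'I_m.+1 | a <= j <= c].
have CP (x : {x | x \in C}) : a <= val x <= c by have := valP x; rewrite inE.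
have gP (y : 'I_(c - a).+1) : inord (a + y) \in C.
  by have yac := ltn_ord y; rewrite inE inordK; lia.
have fE (x : {x | x \in C}) : (inord (val x - a) : 'I_(c - a).+1) = val x - a :> nat.
  by rewrite inordK //; have := CP x; lia.
exists (fun x : {x | x \in C} => inord (val x - a) : 'I_(c - a).+1).
  exists (fun y : 'I_(c - a).+1 => exist _ (inord (a + y)) (gP y)) => x.
    case: x => x xC; have := xC; rewrite inE => xac; have xm := ltn_ord x.
    apply: val_inj; apply: val_inj => /=.
    by rewrite !inordK; lia.
  apply: val_inj; have xm := ltn_ord x.
  by rewrite /= (inordK (n' := m)); [rewrite inordK; lia|lia].
case=> [x xC] [y yC]; rewrite /path_graph /induced !adj_rel_sgraph.
rewrite -?(inj_eq val_inj) /= (fE (exist _ x xC)) (fE (exist _ y yC)) /=.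
move: xC yC (Hb x) (Hb y); rewrite !inE.
case: (b _); case: (b _); lia.
Qed.

Lemma card_edges_interval_forest : count b (iota 0 m) <= #|edges interval_forest|.
Proof.
have -> : count b (iota 0 m) = #|[set i : 'I_m | b i]|.
  rewrite -sum1_card -sum1_count big_mkcond /= -[in iota 0 m](subn0 m) big_mkord [RHS]big_mkcond.
  by apply: eq_bigr => i _; rewrite inE.
(* [widen_ord] and [lift ord0] send [i] to the vertices with values [i] and [i.+1]. *)
pose F (i : 'I_m) := [set widen_ord (leqnSn m) i; lift ord0 i].
rewrite -(card_imset (f := F)).
  apply/subset_leq_card/subsetP => A /imsetP[i]; rewrite inE => bi ->.
  have : adj interval_forest (widen_ord (leqnSn m) i) (lift ord0 i).
    by rewrite adj_interval_forest /= /bump /= eqxx bi.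
  by [].
move=> i j /set2_eq[[/(congr1 val)/= ij _]|[/(congr1 val)/= + /(congr1 val)/=]].
  exact: val_inj.
by rewrite /bump /=; lia.
Qed.

End IntervalForest.

Lemma nlinks_nth (T : eqType) (e : rel T) (x0 : T) s :
  nlinks e s = count (fun i => e (nth x0 s i) (nth x0 s i.+1)) (iota 0 (size s).-1).
Proof.
elim: s => [|x [|y s] IH] //; rewrite nlinks_cons2 IH /=.
by rewrite -[in iota 1 _](addn0 1) iotaDl count_map.
Qed.

(** * Freeness in terms of enumerations *)

Section FamilyFree.
Variables (T : finType) (k : nat).

(** This is freeness for [linear_forests #|T| k] restated through enumerations; the next two lemmas
    give both directions. *)
Definition few_links (G : sgraph T) :=
  forall s, uniq s -> size s = #|T| -> nlinks (adj G) s < #|T| - k + 1.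

Lemma family_free_few_links G : family_free (linear_forests #|T| k) G -> 0 < #|T| -> few_links G.
Proof.
move=> free T0 s us ss; rewrite ltnNge; apply/negP => ls.
have [x0 _] : exists x0 : T, x0 \in T by apply/card_gt0P.
case: s us ss ls => [_ E|x s']; first by rewrite -E in T0.
set s := x :: s' => us ss ls.
rewrite -ss in T0 ls free.
pose b i := adj G (nth x0 s i) (nth x0 s i.+1).
(* The links of [s] form this interval forest, which [nth x0 s] embeds as a spanning subgraph. *)
apply: (free 'I_(size s).-1.+1 (interval_forest (size s).-1 b)).
  split; first by rewrite card_ord.
    exact: linear_forest_interval.
  by apply: leq_trans ls _; rewrite (nlinks_nth _ x0) card_edges_interval_forest.
apply: (@contains_embedding _ _ _ _ (fun i : 'I_(size s).-1.+1 => nth x0 s i)).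
  apply: inj_card_bij; last by rewrite card_ord -ss.
  move=> i j /eqP; rewrite nth_uniq //; first by move/eqP/val_inj.
move=> i j; rewrite adj_interval_forest.
by case/orP=> /andP[/eqP<- bij]; rewrite // adj_sym.
Qed.

Lemma few_links_family_free G : few_links G -> family_free (linear_forests #|T| k) G.
Proof.
move=> few U H [cU LF eH] /contains_inj[f finj fadj].
have [s [us sE sH]] := linear_forest_seq LF.
have ss : size (map f s) = #|T|.
  by rewrite size_map -cU -(card_uniqP us); apply: eq_card.
have := few (map f s); rewrite map_inj_uniq // ltnNge => /(_ us ss)/negP[].
apply: leq_trans eH _; apply: leq_trans (card_edges_le_nlinks sH) _.
rewrite {ss sH sE us}; elim: s => [|x [|y s] IH] //.
rewrite /= in IH *; rewrite !nlinks_cons2 leq_add //.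
by case: (boolP (adj H x y)) => // /fadj ->.
Qed.

End FamilyFree.

(** * Ore's rotation argument *)

Section Ore.
Variables (T : finType) (k : nat) (G : sgraph T).
Hypotheses (k2 : 2 <= k) (kT : k <= #|T|) (few : few_links k G).

(** Reversing the block before the junction [z], [w] turns it into [u], [w]; reversing the block
    after it turns it into [z], [v]. The link count is already the largest that [few] allows, so if
    [z], [w] is no link, neither new junction is one. If it is a link, only the case where both new
    junctions are links has to be excluded. *)
Lemma few_links_rotation (u v z w : T) p q : u :: behead (rcons p z) = rcons p z ->
    last w q = v -> uniq (rcons p z ++ w :: q) -> size (rcons p z ++ w :: q) = #|T| ->
    #|T| - k <= nlinks (adj G) (rcons p z ++ w :: q) ->
  adj G u w + adj G z v <= adj G z w.
Proof.
set e := adj G; set a := rcons p z; set c := w :: q => ua lv us ss ls.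
have es : symmetric e := adj_sym G.
have Ls := nlinks_cat e p z w q; rewrite -/a -/c in Ls.
have [a' ra] : exists a', rev a = rcons a' u by exists (rev (behead a)); rewrite -rev_cons ua.
have [q' rc] : exists q', rev c = v :: q'.
  by rewrite /c -lv lastI rev_rcons; eexists.
have perm t : perm_eq t (a ++ c) -> nlinks e t < #|T| - k + 1.
  by move=> pt; apply: few; [rewrite (perm_uniq pt)|rewrite (perm_size pt)].
have H1 : nlinks e a + e u w + nlinks e c < #|T| - k + 1.
  rewrite -(nlinks_rev a es) ra -nlinks_cat -ra; apply: perm.
  by rewrite perm_cat2r perm_rev.
have H2 : nlinks e a + e z v + nlinks e c < #|T| - k + 1.
  rewrite -(nlinks_rev c es) rc -nlinks_cat -rc; apply: perm.
  by rewrite perm_cat2l perm_rev.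
rewrite Ls in ls.
(* If all three adjacencies hold, the rotated enumeration closes up into a cycle,
   which is cut at a non-link to gain a link. *)
case zw: (e z w) in ls *; case uw: (e u w) in H1 *; case zv: (e z v) in H2 *; try lia.
have pt : perm_eq (rev a ++ c) (a ++ c) by rewrite perm_cat2r perm_rev.
have Lt : nlinks e (rev a ++ c) = nlinks e a + 1 + nlinks e c.
  by rewrite ra nlinks_cat -ra nlinks_rev // uw.
have [|s1 [x [y [s2 [E nxy]]]]] := @nlinks_count_lt _ e (rev a ++ c).
  by rewrite (perm_size pt) ss Lt; lia.
have Lt2 : nlinks e (rev a ++ c) = nlinks e (rcons s1 x) + nlinks e (y :: s2).
  by rewrite E nlinks_cat (negbTE nxy) addn0.
(* The first piece starts with [z] and the second ends with [v], so swapping them trades the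
   non-link [x], [y] for the link [v], [z]. *)
have [t1 Et1] : exists t1, rcons s1 x = z :: t1.
  have : head z (rcons s1 x) = z.
    have : head z (rev a ++ c) = z by rewrite /a rev_rcons.
    by rewrite E; case: (s1).
  by case: (s1) => [|x1 s1'] /= ->; eexists.
have [t2 Et2] : exists t2, y :: s2 = rcons t2 v.
  exists (belast y s2); rewrite -lv (_ : last w q = last z (rev a ++ c)).
    by rewrite E last_cat /= -lastI.
  by rewrite last_cat.
have := perm (rcons t2 v ++ z :: t1).
rewrite -Et2 -Et1 perm_catC -E => /(_ pt).
rewrite Et2 Et1 nlinks_cat -Et1 -Et2 (es v) zv.
by rewrite Lt2 in Lt; lia.
Qed.

(** Summing [few_links_rotation] over the consecutive pairs charges all neighbours of the two ends
    to links, of which there are at most [#|T| - k]. *)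
Lemma deg_add_nonadj u v s : uniq s -> size s = #|T| -> head u s = u -> last v s = v ->
  u != v -> #|T| - k <= nlinks (adj G) s -> deg G u + deg G v <= #|T| - k.
Proof.
case: s => [|x t] us ss /= hu lv uv ls.
  by have /card_gt0P := ex_intro (fun y => y \in T) u isT; rewrite -ss.
rewrite {x}hu in us ss lv ls.
have nE : nlinks (adj G) (u :: t) <= #|T| - k.
  by have := few us ss; lia.
apply: leq_trans nE.
have degE y : deg G y = count (adj G y) (u :: t).
  rewrite /deg -size_filter -(card_uniqP (filter_uniq _ us)); apply: eq_card => z.
  have full : u :: t =i predT by apply/subset_cardP; rewrite ?subset_predT // (card_uniqP us).
  by rewrite inE mem_filter full andbT.
have -> : deg G v = count (adj G^~ v) (belast u t).
  by rewrite degE (eq_count (adj_sym G v)) lastI -cats1 count_cat lv /= adj_irrefl !addn0.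
rewrite degE /= adj_irrefl add0n.
apply: count_ends_le_nlinks => p z w q E.
rewrite E in us ss ls.
apply: (few_links_rotation _ _ us ss ls); last first.
  by have /= := congr1 (last u) E; rewrite last_cat /= lv.
by case: (p) E => [|p0 p'] [<-].
Qed.

End Ore.

(** * Degree sums of nonadjacent pairs *)

Section EdgeMaximal.
Variables (T : finType) (k : nat) (G : sgraph T).
Hypotheses (k2 : 2 <= k) (kT : k <= #|T|) (few : few_links k G).

(** Here [r] stands for [G] with [u], [v] joined. Cutting [s] between [v] and [u] and swapping the
    blocks gives an enumeration from [u] to [v]. At most one link is lost, and no block contains
    both [u] and [v], so the remaining links lie in [G]. *)
Lemma deg_add_of_links (r : rel T) (u v : T) s : u != v ->
    (forall x y, r x y -> adj G x y \/ [set x; y] = [set u; v]) ->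
    uniq s -> size s = #|T| -> infix [:: v; u] s -> #|T| - k + 1 <= nlinks r s ->
  deg G u + deg G v <= #|T| - k.
Proof.
move=> uv rG us ss /infixP[p [q E]] ls.
have {}E : s = rcons p v ++ u :: q by rewrite E -cats1 -catA.
have us' : uniq (rcons p v ++ u :: q) by rewrite -E.
have perm : perm_eq ((u :: q) ++ rcons p v) s by rewrite E perm_catC.
have subl t : ~~ ((u \in t) && (v \in t)) -> nlinks r t <= nlinks (adj G) t.
  move=> uvt; apply: sub_nlinks => x y xy /rG[//|Exy].
  have [xt yt] : x \in t /\ y \in t by split; apply: (mem_infix xy); rewrite !inE eqxx ?orbT.
  by case/negP: uvt; case: (set2_eq Exy) => [[<- <-]|[<- <-]]; rewrite xt yt.
have := us'; rewrite cat_uniq => /and3P[_ /hasPn disj _].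
have l1 : nlinks r (rcons p v) <= nlinks (adj G) (rcons p v).
  by apply: subl; rewrite negb_and; have /= -> := disj u (mem_head _ _).
have l2 : nlinks r (u :: q) <= nlinks (adj G) (u :: q).
  apply: subl; rewrite negb_and; apply/orP; right.
  by apply/negP => /disj; rewrite mem_rcons mem_head.
apply: (@deg_add_nonadj _ _ _ k2 kT few u v ((u :: q) ++ rcons p v)) => //.
- by rewrite (perm_uniq perm).
- by rewrite (perm_size perm).
- by rewrite last_cat last_rcons.
move: ls; rewrite E nlinks_cat => ls.
have lc : nlinks (adj G) (u :: q) + nlinks (adj G) (rcons p v) <=
    nlinks (adj G) ((u :: q) ++ rcons p v).
  by rewrite lastI; case: (p) => [|p0 p'] /=; rewrite nlinks_cat -addnA leq_add2l leq_addl.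
apply: leq_trans lc; apply: leq_trans (leq_add l2 l1); move: ls.
by move: (nlinks r _) (nlinks r _) (r v u) => a b []; lia.
Qed.

(** An enumeration with too many links must use the new edge, in one of its two directions, since
    otherwise it would contradict [few] in [G]. *)
Lemma deg_add_add_edge (u v : T) (uv : u != v) : ~ few_links k (add_edge G uv) ->
  deg G u + deg G v <= #|T| - k.
Proof.
move=> nfew; apply: contrapT => nle; apply: nfew => s us ss.
rewrite ltnNge; apply/negP => ls; apply: nle.
set r := adj (add_edge G uv) in ls.
have rG x y : r x y -> adj G x y \/ [set x; y] = [set u; v].
  by rewrite /r /adj /= !inE => /orP[/eqP|]; [right|left].
case: (boolP (infix [:: v; u] s)) => [|nvu]; first by move/(deg_add_of_links uv rG us ss)/(_ ls).
case: (boolP (infix [:: u; v] s)) => [|nuv].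
  rewrite addnC => iuv; apply: (@deg_add_of_links r v u s) => //; first by rewrite eq_sym.
  by move=> x y /rG; rewrite [[set v; u]]setUC.
have := few us ss; rewrite ltnNge => /negP[]; apply: leq_trans ls _.
apply: sub_nlinks => x y xy /rG[//|/set2_eq[][ex ey]]; move: xy; rewrite ex ey.
  by rewrite (negbTE nuv).
by rewrite (negbTE nvu).
Qed.

Lemma exists_nonadj : exists u v, u != v /\ ~~ adj G u v.
Proof.
have us := enum_uniq T; have ss : size (enum T) = #|T| by rewrite cardE.
have [|s1 [x [y [s2 [E nxy]]]]] := @nlinks_count_lt _ (adj G) (enum T).
  by move: (few us ss) kT; rewrite ss; move: #|T| (nlinks _ _) => t a; lia.
exists x, y; split=> //; apply: contraL us => /eqP xy.
by rewrite E cat_uniq /= xy mem_rcons mem_head /= andbF.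
Qed.

End EdgeMaximal.

(** * Degree-sum count and the final bound *)

(* Chvatal's count for a nonadjacent pair with d(u) <= d(v) and d(u) + d(v) maximal:
   non-neighbours of v have degree at most d(u), those of u at most d(v). *)
Lemma sum_deg_bound (T : finType) (G : sgraph T) k : 0 < k <= #|T| ->
    (forall u v, u != v -> ~~ adj G u v -> deg G u + deg G v <= #|T| - k) ->
    (exists u v, u != v /\ ~~ adj G u v) ->
  exists2 s, s.*2 <= #|T| - k &
    \sum_x deg G x + ((k - 1 + s) * (#|T| - s) + (#|T| - k - s.*2) * (s + k - 1))
      <= #|T| * (#|T| - 1).
Proof.
move=> kT ore [u0 [v0 nuv0]].
pose P (p : T * T) := (p.1 != p.2) && ~~ adj G p.1 p.2.
have [u [v [uv nuv le_uv max]]] : exists u v, [/\ u != v, ~~ adj G u v, deg G u <= deg G v &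
    forall x y, x != y -> ~~ adj G x y -> deg G x + deg G y <= deg G u + deg G v].
  have P0 : P (u0, v0) by apply/andP.
  case: (arg_maxnP (fun p => deg G p.1 + deg G p.2) P0) => -[u v] /andP[/= uv nuv] max.
  have max' x y : x != y -> ~~ adj G x y -> deg G x + deg G y <= deg G u + deg G v.
    by move=> xy nxy; apply: (max (x, y)); apply/andP.
  case: (leqP (deg G u) (deg G v)) => [uv_le|/ltnW vu_le]; first by exists u, v.
  exists v, u; split=> //; [by rewrite eq_sym|by rewrite adj_sym|].
  by move=> x y xy nxy; rewrite (addnC (deg G v)) max'.
have o := ore _ _ uv nuv.
(* [v] is left out of [A] because its degree may exceed [deg G u]; [u] may stay in [B], whose bound
   it satisfies. *)
pose A := [set w | (w != v) && ~~ adj G v w].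
pose B := [set w | ~~ adj G u w].
have cB : #|B| = #|T| - deg G u.
  have := cardC [set y | adj G u y]; rewrite -/(deg G u) => <-.
  by rewrite addKn; apply: eq_card => y; rewrite !inE.
have cA : #|A| = #|T| - deg G v - 1.
  have := cardC [set y | adj G v y]; rewrite -/(deg G v) => <-.
  rewrite addKn (cardD1 v [predC _]) !inE adj_irrefl add1n subn1 /=.
  by apply: eq_card => y; rewrite !inE.
have degle w : deg G w <= #|T| - 1.
  have := cardC [set y | adj G w y]; rewrite -/(deg G w) (cardD1 w [predC _]) !inE adj_irrefl /=.
  by lia.
exists (deg G u); first by lia.
set s := deg G u in o le_uv cB max *.
(* The two weights are the successive drops from [#|T| - 1] to [#|T| - k - s], the bound on [B], and
   from there to [s], the bound on [A]. *)
have key w : deg G w + ((k - 1 + s) * (w \in B) + (#|T| - k - s.*2) * (w \in A)) <= #|T| - 1.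
  have dA : w \in A -> deg G w <= s.
    rewrite inE => /andP[wv nvw]; have := max w v wv; rewrite adj_sym => /(_ nvw).
    by rewrite leq_add2r.
  have dB : w \in B -> deg G w <= #|T| - k - s.
    rewrite inE => nuw; have [->|wu] := eqVneq w u; first by rewrite -/s; lia.
    have := max w u wu; rewrite adj_sym => /(_ nuw); rewrite -/s; lia.
  have := degle w.
  by case: (w \in A) dA => [/(_ isT)|_]; case: (w \in B) dB => [/(_ isT)|_]; lia.
have : \sum_w (deg G w + ((k - 1 + s) * (w \in B) + (#|T| - k - s.*2) * (w \in A)))
    <= \sum_(w : T) (#|T| - 1) by apply: leq_sum.
rewrite sum_nat_const !big_split /= -!big_distrr /=.
have sumE (C : {set T}) : \sum_w (w \in C : nat) = #|C|.
  by rewrite -sum1_card [RHS]big_mkcond; apply: eq_bigr => w _; case: (w \in C).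
rewrite !sumE cB; apply: leq_trans.
rewrite !leq_add2l leq_mul2l cA; apply/orP; right; lia.
Qed.

(** With [r = n - k - 2s] and [d = k - s] over the integers, the claimed bound on [2e] exceeds the
    one in the hypothesis by [d^2 - 3d + 4 + 2rs], which is positive. *)
Lemma edges_arith n k s e : 2 <= k -> 3 * k <= n -> s.*2 <= n - k ->
    e.*2 + ((k - 1 + s) * (n - s) + (n - k - s.*2) * (s + k - 1)) <= n * (n - 1) ->
  e.*2 + 3 * k <= (n - k + 1) * (n - k) + k ^ 2 + 4.
Proof.
move=> k2 kn sn; have [r En] : exists r, n = s.*2 + r + k by exists (n - k - s.*2); lia.
have -> : n - k - s.*2 = r by lia.
have -> : n - k = s.*2 + r by lia.
have -> : n - s = s + r + k by lia.
have [j Ej] : exists j, k = j + 2 by exists (k - 2); lia.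
have -> : k - 1 = j + 1 by lia.
have -> : s + k - 1 = s + j + 1 by lia.
have -> : n - 1 = s.*2 + r + j + 1 by lia.
have rk : k.*2 <= s.*2 + r by lia.
have kE : k ^ 2 = k * k by rewrite expnS expn1.
rewrite {}En {}kE -!muln2 => H.
have [sk|ks] := leqP s k.
  have [d Ed] : exists d, k = s + d by exists (k - s); lia.
  have [t Er] : exists t, r = d.*2 + t by exists (r - d.*2); lia.
  have F : 3 * d <= d * (4 * s + d) + 4.
    by case: (d) => [|[|[|d']]] //; lia.
  have jE : j + 2 = s + d by lia.
  clear -H F jE Ed Er.
  subst r k.
  (* Multiples of [jE] by each variable, so that [lia] can treat the products as atoms. *)
  have Q : (j + 2) * s = (s + d) * s by rewrite jE.
  have Q1 : (j + 2) * d = (s + d) * d by rewrite jE.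
  have Q2 : (j + 2) * j = (s + d) * j by rewrite jE.
  have Q3 : (j + 2) * t = (s + d) * t by rewrite jE.
  rewrite -!muln2 in H *.
  lia.
have [d Ed] : exists d, s = k + d by exists (s - k); lia.
clear -H Ej Ed; subst s k.
lia.
Qed.

Lemma max_free_card_edges n k (G : sgraph 'I_n) : 2 <= k -> 3 * k <= n ->
    family_free (linear_forests n k) G ->
    (forall G' : sgraph 'I_n, family_free (linear_forests n k) G' -> #|edges G'| <= #|edges G|) ->
  #|edges G|.*2 + 3 * k <= (n - k + 1) * (n - k) + k ^ 2 + 4.
Proof.
move=> k2 kn; have cn := card_ord n; rewrite -[X in linear_forests X]cn => free max.
have n0 : 0 < #|'I_n| by lia.
have few := family_free_few_links free n0.
have kT : k <= #|'I_n| by lia.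
have [|||s sn H] := @sum_deg_bound _ G k.
- by rewrite kT ltnW.
(* If adding the missing edge preserved [few_links], the result would be a free graph with more
   edges than [G]. *)
- move=> u v uv nuv; apply: (deg_add_add_edge k2 kT few (uv := uv)) => few'.
  have := max _ (few_links_family_free few'); rewrite /= cardsU1.
  by rewrite -[_ \notin _]/(~~ adj G u v) nuv ltnn.
- exact: exists_nonadj k2 kT few.
rewrite cn in sn H; apply: (edges_arith k2 kn sn); apply: leq_trans H.
by rewrite leq_add2r card_edges_le_sum_deg.
Qed.

Local Open Scope ring_scope.

Theorem theorem3p1 (n k : nat) (hk : (2 <= k)%N) (hn : (3 * k <= n)%N) :
  (ex n (linear_forests n k))%:R
    <= 'C(n - k + 1, 2)%:R + (k%:R ^+ 2 - 3%:R * k%:R + 4%:R) / 2%:R :> rat.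
Proof.
(* The bound is doubled and [3 * k] moved to the left to stay within the natural numbers. *)
have ex_le : ((ex n (linear_forests n k)).*2 + 3 * k <= (n - k + 1) * (n - k) + k ^ 2 + 4)%N.
  rewrite /ex; have [G0 freeG0|nofree] :=
    pickP (fun G : sgraph 'I_n => `[< family_free (linear_forests n k) G >]); last first.
    (* Without any free graph the maximum is [0] by default, and the bound still holds. *)
    by rewrite big_pred0 //; nia.
  rewrite (bigop.bigmax_eq_arg G0) //.
  case: arg_maxnP => // G /asboolP freeG max.
  by apply: max_free_card_edges => // G' /asboolP/max.
have C2 : ('C(n - k + 1, 2) * 2 = (n - k + 1) * (n - k))%N.
  by rewrite -[2%N in LHS]/(2`!) bin_ffact ffactnS ffactn1 addn1.
move: ex_le; rewrite -C2 -muln2 -(ler_nat rat) !natrD !natrM.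
lra.
Qed.
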